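(* Let $\mathcal{S}_T$ and $\mathcal{S}_K$ be disjoint finite index sets with $T=|\mathcal{S}_T|$ and $K=|\mathcal{S}_K|$, let $y$ and $x_i$ ($i\in \mathcal{S}_T\cup\mathcal{S}_K$) be distinct propositional variables, and let $\varphi$ be the logical implication $$y \leftarrow \bigwedge_{t\in \mathcal{S}_T} x_t \wedge \bigwedge_{k\in\mathcal{S}_K}\neg x_k .$$ Let $0<\epsilon<1$ and fix any linear order (elimination order) on $\mathcal{S}_T\cup\mathcal{S}_K$. Then $\varphi$ is represented by (i.e. is equivalent to) the restricted Boltzmann machine with visible units $y$ and $x_i$ ($i\in\mathcal{S}_T\cup\mathcal{S}_K$), hidden units $h_y$ and $h_p$ ($p\in\mathcal{S}_T\cup\mathcal{S}_K$), all taking values in $\{0,1\}$, and energy function $$E = -h_y\Big(\sum_{t\in\mathcal{S}_T}x_t - \sum_{k\in\mathcal{S}_K}x_k + y - T - 1 + \epsilon\Big) - \sum_{p\in\mathcal{S}_T\cup\mathcal{S}_K} h_p\Big(\sum_{t\in\mathcal{S}_T\backslash p}x_t - \sum_{k\in\mathcal{S}_K\backslash p}x_k + x'_p - |\mathcal{S}_T\backslash p| - \mathbb{I}_{p\in\mathcal{S}_K}+\epsilon\Big),$$ where, for $\mathcal{S}\in\{\mathcal{S}_T,\mathcal{S}_K\}$, $\mathcal{S}\backslash p$ denotes the set $\mathcal{S}$ after $p$ and all indices preceding $p$ in the elimination order have been removed, $|\mathcal{S}\backslash p|$ is the size of that set, and $x'_p=-x_p$, $\mathbb{I}_{p\in\mathcal{S}_K}=0$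 if $p\in\mathcal{S}_T$, while $x'_p=x_p$, $\mathbb{I}_{p\in\mathcal{S}_K}=1$ if $p\in\mathcal{S}_K$.
   Context: A restricted Boltzmann machine (RBM) with binary visible units $v_i\in\{0,1\}$ and binary hidden units $h_j\in\{0,1\}$ is a network characterised by an energy function of the form $E(\mathbf{v},\mathbf{h}) = -\sum_{i,j} w_{ij}v_ih_j - \sum_i a_i v_i - \sum_j b_j h_j$ with real weights $w_{ij}$ and real biases $a_i,b_j$. Its energy ranking function is $E_{rank}(\mathbf{v})=\min_{\mathbf{h}}E(\mathbf{v},\mathbf{h})$, minimised over all values in $\{0,1\}$ of the hidden units. Truth values are identified with numbers by True $\equiv 1$, False $\equiv 0$, and $s_\varphi(\mathbf{v})\in\{0,1\}$ denotes the truth value of the formula $\varphi$ under the truth assignment $\mathbf{v}$. A formula $\varphi$ is equivalent to (represented by) a network $\mathcal{N}$ with energy ranking function $E_{rank}$ if and only if there are constants $A>0$ and $B$ such that for every truth assignment $\mathbf{v}$, $s_\varphi(\mathbf{v}) = -A\,E_{rank}(\mathbf{v})+B$. *)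

(* Defs.v *)
From HB Require Import structures.
From mathcomp Require Import all_boot all_order all_algebra.
From mathcomp Require Import reals.

Set Implicit Arguments.
Unset Strict Implicit.
Unset Printing Implicit Defensive.

Import Order.TTheory GRing.Theory Num.Theory.
Local Open Scope ring_scope.

Inductive formula (V : Type) : Type :=
  | FTrue
  | FVar of V
  | FNot of formula V
  | FAnd of formula V & formula V
  | FImp of formula V & formula V.

Arguments FTrue {V}.

Fixpoint eval (V : Type) (v : V -> bool) (phi : formula V) : bool :=
  match phi with
  | FTrue => true
  | FVar i => v i
  | FNot p => ~~ eval v p
  | FAnd p q => eval v p && eval v q
  | FImp p q => eval v p ==> eval v q
  end.

(* Units take values in {0,1}: a configuration of a layer U of units is a
   boolean function on U, a boolean b being read as the number b%:R. *)
Definition config (U : finType) : Type := {ffun U -> bool}.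

Definition truth_value (R : realType) (V : finType) (phi : formula V)
  (v : config V) : R := (eval v phi)%:R.

Record rbm (R : realType) (V H : finType) : Type := RBM {
  weight : V -> H -> R;
  visible_bias : V -> R;
  hidden_bias : H -> R
}.

Definition energy (R : realType) (V H : finType) (N : rbm R V H)
  (v : config V) (h : config H) : R :=
  - (\sum_i \sum_j weight N i j * (v i)%:R * (h j)%:R)
  - \sum_i visible_bias N i * (v i)%:R
  - \sum_j hidden_bias N j * (h j)%:R.

(* The default value of the iterated minimum is the energy of a genuine hidden
   configuration (all units off), so it does not affect the minimum. *)
Definition energy_rank (R : realType) (V H : finType) (N : rbm R V H)
  (v : config V) : R :=
  \big[Num.min/energy N v [ffun=> false]]_(h : {ffun H -> bool}) energy N v h.

Definition represented_by (R : realType) (V H : finType) (phi : formula V)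
  (N : rbm R V H) : Prop :=
  exists A B : R, 0 < A /\
    forall v : config V, truth_value R phi v = - A * energy_rank N v + B.

(* The variables (and visible units) form [option I]: [None] is y and
   [Some i] is x_i.  Likewise for hidden units, [None] is h_y and [Some p]
   is h_p. *)
Definition implication (I : finType) (ST SK : {set I}) : formula (option I) :=
  FImp
    (FAnd (\big[@FAnd (option I)/FTrue]_(t in ST) FVar (Some t))
          (\big[@FAnd (option I)/FTrue]_(k in SK) FNot (FVar (Some k))))
    (FVar None).

(* S \ p, the elimination order being the order of I. *)
Definition eliminate (d : Order.disp_t) (I : finOrderType d) (S : {set I})
  (p : I) : {set I} := [set i in S | (p < i)%O].

Definition implication_energy (R : realType) (d : Order.disp_t)
  (I : finOrderType d) (ST SK : {set I}) (eps : R)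
  (v h : config (option I)) : R :=
  let y : R := (v None)%:R in
  let x (i : I) : R := (v (Some i))%:R in
  let x' (p : I) : R := if p \in ST then - x p else x p in
  let hy : R := (h None)%:R in
  let hid (p : I) : R := (h (Some p))%:R in
  - hy * (\sum_(t in ST) x t - \sum_(k in SK) x k + y - #|ST|%:R - 1 + eps)
  - \sum_(p in ST :|: SK)
      hid p * (\sum_(t in eliminate ST p) x t
               - \sum_(k in eliminate SK p) x k
               + x' p - #|eliminate ST p|%:R - (p \in SK)%:R + eps).

(* Main.v *)
(** For a fixed assignment the hidden units do not interact, so the minimum
    over [h] is attained by switching on exactly the units with positive input,
    and [E_rank] is minus the sum of the positive parts of the inputs.  Every
    input has the form [eps - n] with [n] a natural number, so its positive part
    is [eps] if [n = 0] and [0] otherwise.  For [h_y], [n = 0] iff the body of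
    the implication and [y] hold; for [h_p], [n = 0] iff [p] is the last index
    whose literal is false.  These events are mutually exclusive, and one of
    them occurs iff the implication is true, so [E_rank = - eps * s]. *)

Require Import Defs.
From HB Require Import structures.
From mathcomp Require Import all_boot all_order all_algebra.
From mathcomp Require Import reals.
From mathcomp Require Import ring.

Set Implicit Arguments.
Unset Strict Implicit.
Unset Printing Implicit Defensive.

Import Order.TTheory GRing.Theory Num.Theory.
Local Open Scope ring_scope.

Section RestrictedBoltzmannMachine.
Variables (R : realType) (V H : finType) (N : rbm R V H).

Definition hidden_input (v : config V) (j : H) : R :=
  \sum_i weight N i j * (v i)%:R + hidden_bias N j.

(** Swapping the double sum collects everything that multiplies [h j], so the energy is affine in
    each hidden unit separately and can be minimised unit by unit. *)
Lemma energyE (v : config V) (h : config H) :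
  energy N v h = - (\sum_i visible_bias N i * (v i)%:R)
                 - \sum_j (h j)%:R * hidden_input v j.
Proof.
rewrite /energy exchange_big /=.
have -> : \sum_j (h j)%:R * hidden_input v j =
    \sum_j \sum_i weight N i j * (v i)%:R * (h j)%:R
    + \sum_j hidden_bias N j * (h j)%:R.
  rewrite -big_split /=; apply: eq_bigr => j _.
  by rewrite mulrDr mulr_sumr mulrC -mulr_suml mulrC -mulr_sumr;
     congr (_ + _); rewrite mulrC.
ring.
Qed.

Lemma energy_rankE (v : config V) :
  energy_rank N v = - (\sum_i visible_bias N i * (v i)%:R)
                    - \sum_j Num.max 0 (hidden_input v j).
Proof.
have lb (h : config H) : - (\sum_i visible_bias N i * (v i)%:R)
    - \sum_j Num.max 0 (hidden_input v j) <= energy N v h.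
  rewrite energyE lerD2l lerN2; apply: ler_sum => j _.
  by case: (h j); rewrite ?mul1r ?mul0r le_max lexx ?orbT.
apply/le_anti/andP; split; last by apply: le_bigmin => [|h _]; exact: lb.
pose h : config H := [ffun j => 0 < hidden_input v j].
apply: (le_trans (bigmin_le _ h _)) => //.
rewrite energyE lerD2l lerN2; apply: ler_sum => j _.
by rewrite /h ffunE; case: ltP => _; rewrite ?mul1r ?mul0r.
Qed.

End RestrictedBoltzmannMachine.

Lemma sum_option (V : nmodType) (I : finType) (F : option I -> V) :
  \sum_i F i = F None + \sum_i F (Some i).
Proof.
rewrite (bigD1 None) //=; congr (_ + _).
rewrite (reindex_omap Some id) => [|[i|]] //.
by apply: eq_bigl => i; rewrite eqxx.
Qed.

(** Since [eps < 1], the difference is negative as soon as [n] is at least 1, so the positive part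
    tests whether [n] vanishes. *)
Lemma maxr0_sub_nat (R : realType) (eps : R) (n : nat) :
  0 < eps -> eps < 1 -> Num.max 0 (eps - n%:R) = eps * (n == 0)%:R.
Proof.
move=> e0 e1; case: n => [|n] /=.
  by rewrite subr0 mulr1; apply/max_idPr/ltW.
rewrite mulr0; apply/max_idPl.
by rewrite subr_le0 (le_trans (ltW e1)) // ler1n.
Qed.

Lemma eval_big_FAnd (V I : Type) (v : V -> bool) (r : seq I) (P : pred I)
    (F : I -> formula V) :
  eval v (\big[@FAnd V/FTrue]_(i <- r | P i) F i)
  = \big[andb/true]_(i <- r | P i) eval v (F i).
Proof. exact: (big_morph (eval v)). Qed.

(** If [P] holds somewhere, its greatest witness exists and is unique because the order is total, so
    exactly one summand is 1. *)
Lemma sum_last (d : Order.disp_t) (I : finOrderType d) (P : pred I) :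
  (\sum_p (P p && [forall (i | (p < i)%O), ~~ P i]) = [exists p, P p])%N.
Proof.
case: existsP => [[p0 Pp0]|noP]; last first.
  by apply: big1 => p _; case: (boolP (P p)) => // Pp; case: noP; exists p.
case: (arg_maxP id Pp0) => m Pm mmax.
rewrite (bigD1 m) //= Pm big1 ?addn0 => [|p pm].
  have -> // : [forall (i | (m < i)%O), ~~ P i].
  by apply/forall_inP => i; apply: contraTN => Pi; rewrite -leNgt; exact: mmax.
case: (boolP (P p)) => //= Pp; case: forall_inP => // /(_ m).
have -> : (p < m)%O by rewrite lt_neqAle pm; exact: mmax.
by rewrite Pm => /(_ isT).
Qed.

Section Implication.
Variables (R : realType) (d : Order.disp_t) (I : finOrderType d).
Variables (ST SK : {set I}) (eps : R).

(** The weights are the coefficients of the target energy, with index sets turned into indicators.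
    The diagonal term [i == p] carries $x'_p$. *)
Definition implication_rbm : rbm R (option I) (option I) := {|
  weight := fun i j => match i, j with
    | None, None => 1
    | None, Some _ => 0
    | Some i, None => (i \in ST)%:R - (i \in SK)%:R
    | Some i, Some p =>
        (i \in eliminate ST p)%:R - (i \in eliminate SK p)%:R
        + (if p \in ST then -1 else 1) * (i == p)%:R
    end;
  visible_bias := fun _ => 0;
  hidden_bias := fun j => match j with
    | None => - #|ST|%:R - 1 + eps
    | Some p => - #|eliminate ST p|%:R - (p \in SK)%:R + eps
    end |}.

Let sum_mem (S : {set I}) (x : I -> R) :
  \sum_i (i \in S)%:R * x i = \sum_(i in S) x i.
Proof.
rewrite [RHS]big_mkcond; apply: eq_bigr => i _.
by case: ifP; rewrite ?mul1r ?mul0r.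
Qed.

Lemma hidden_input_None (v : config (option I)) :
  hidden_input implication_rbm v None =
  \sum_(t in ST) (v (Some t))%:R - \sum_(k in SK) (v (Some k))%:R
  + (v None)%:R - #|ST|%:R - 1 + eps.
Proof.
rewrite /hidden_input sum_option /=.
under eq_bigr do rewrite mulrBl.
rewrite sumrB !(sum_mem _ (fun i => (v (Some i))%:R)); ring.
Qed.

Lemma hidden_input_Some (v : config (option I)) (p : I) :
  hidden_input implication_rbm v (Some p) =
  \sum_(t in eliminate ST p) (v (Some t))%:R
  - \sum_(k in eliminate SK p) (v (Some k))%:R
  + (if p \in ST then - (v (Some p))%:R else (v (Some p))%:R)
  - #|eliminate ST p|%:R - (p \in SK)%:R + eps.
Proof.
rewrite /hidden_input sum_option /=.
under eq_bigr do rewrite mulrDl mulrBl.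
rewrite big_split sumrB /= !(sum_mem _ (fun i => (v (Some i))%:R)).
rewrite [\sum_i _ * _ * _](bigD1 p) //= eqxx mulr1.
rewrite [\sum_(i | i != p) _]big1 => [|i /negPf->]; last by rewrite mulr0 mul0r.
case: ifP => _; ring.
Qed.

Hypotheses (disjoint_STK : [disjoint ST & SK])
  (cover_STK : ST :|: SK = [set: I]).

Lemma energy_implication_rbm (v h : config (option I)) :
  energy implication_rbm v h = implication_energy ST SK eps v h.
Proof.
rewrite energyE big1 => [|i _]; last by rewrite mul0r.
rewrite sum_option /= hidden_input_None /implication_energy.
under eq_bigr do rewrite hidden_input_Some.
(* The machine has a unit for every index of [I]; covering makes the sum over [ST :|: SK] range over
   the same indices. *)
under [X in _ = _ - X]eq_bigl do rewrite cover_STK inE.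
ring.
Qed.

Let in_SK (i : I) : (i \in SK) = (i \notin ST).
Proof.
have := in_setT i; rewrite -cover_STK inE.
by case: (boolP (i \in ST)) => //= iT _; exact: (disjointFr disjoint_STK).
Qed.

(** The body contains [x_i] for [i] in [ST] and its negation for [i] in [SK], so a literal is true
    exactly when the value of [x_i] agrees with membership in [ST]. *)
Definition false_literal (v : config (option I)) (i : I) : bool :=
  v (Some i) != (i \in ST).

(** An index of [ST] contributes $x_i - 1$ and one of [SK] contributes $-x_i$: in both cases -1 if
    the literal is false and 0 otherwise. Taking [P] full serves [h_y]; taking the indices after [p]
    serves [h_p]. *)
Lemma sum_literals (v : config (option I)) (P : pred I) :
  \sum_(t in [set i in ST | P i]) (v (Some t))%:R
  - \sum_(k in [set i in SK | P i]) (v (Some k))%:R - #|[set i in ST | P i]|%:R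
  = - (\sum_(i | P i) false_literal v i)%:R :> R.
Proof.
have sumE (S : {set I}) (F : I -> R) :
    \sum_(i in [set i in S | P i]) F i
    = \sum_(i | P i) if i \in S then F i else 0.
  by rewrite -big_mkcondl; apply: eq_bigl => i; rewrite inE.
rewrite -sum1_card !natr_sum !sumE -!sumrN -!big_split /=.
apply: eq_bigr => i _; rewrite in_SK /false_literal.
by case: (i \in ST); case: (v _); rewrite /=; ring.
Qed.

Lemma hidden_input_None_nat (v : config (option I)) :
  hidden_input implication_rbm v None =
  eps - (\sum_i false_literal v i + ~~ v None)%:R.
Proof.
have setE (S : {set I}) : [set i in S | predT i] = S.
  by apply/setP => i; rewrite inE andbT.
have := sum_literals v predT; rewrite !setE.
rewrite hidden_input_None natrD => /eqP; rewrite subr_eq => /eqP ->.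
by case: (v None) => /=; ring.
Qed.

(** The own term of [p] is $-x_p$ on [ST] and $x_p - 1$ on [SK], so, contrary to the later indices,
    [p] is penalised when its literal is true. *)
Lemma hidden_input_Some_nat (v : config (option I)) (p : I) :
  hidden_input implication_rbm v (Some p) =
  eps - (\sum_(i | (p < i)%O) false_literal v i + ~~ false_literal v p)%:R.
Proof.
have := sum_literals v (fun i => p < i)%O.
rewrite -!/(eliminate _ _).
rewrite hidden_input_Some natrD => /eqP; rewrite subr_eq => /eqP ->.
rewrite in_SK /false_literal.
by case: (p \in ST); case: (v (Some p)) => /=; ring.
Qed.

Lemma eval_implication (v : config (option I)) :
  eval v (implication ST SK) = [exists i, false_literal v i] || v None.
Proof.
rewrite /= !eval_big_FAnd /= implybE !big_andE.
rewrite -[[exists i, _]]negbK; congr (~~ _ || _).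
apply/andP/existsPn => [[/forall_inP vT /forall_inP vK] i|vl].
  rewrite /false_literal negbK; have := in_SK i.
  by case: (boolP (i \in ST)) => [/vT->|_ /vK] //; case: (v _).
split; apply/forall_inP => i; have := vl i; rewrite /false_literal negbK.
  by move=> /eqP->.
by rewrite in_SK => /eqP->.
Qed.

Lemma energy_rank_implication_rbm (v : config (option I)) :
  0 < eps -> eps < 1 ->
  energy_rank implication_rbm v =
  - eps * truth_value R (implication ST SK) v.
Proof.
move=> e0 e1; rewrite energy_rankE big1 => [|i _]; last by rewrite mul0r.
rewrite sum_option /= hidden_input_None_nat maxr0_sub_nat //.
have -> : \sum_p Num.max 0 (hidden_input implication_rbm v (Some p)) =
    eps * [exists p, false_literal v p]%:R.
  (* The existential is expanded into the events that [p] is the last false literal, to be matched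
     with the units [h_p] one by one. *)
  rewrite -sum_last natr_sum mulr_sumr; apply: eq_bigr => p _.
  rewrite hidden_input_Some_nat maxr0_sub_nat // addn_eq0 sum_nat_eq0 andbC.
  rewrite eqb0 negbK; congr (_ * (_ && _)%:R).
  by apply: eq_forallb => i; rewrite eqb0.
rewrite addn_eq0 sum_nat_eq0 /truth_value eval_implication.
have -> : [forall (i | true), false_literal v i == 0%N :> nat] =
    ~~ [exists i, false_literal v i].
  by rewrite negb_exists; apply: eq_forallb => i; rewrite eqb0.
(* A false literal silences [h_y] and leaves [eps] from the other units; otherwise only [h_y] can
   contribute, and it does so iff [y] holds. *)
by case: [exists i, _]; case: (v None) => /=; ring.
Qed.

End Implication.

Theorem theorem2 (R : realType) (d : Order.disp_t) (I : finOrderType d)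
  (ST SK : {set I}) (disjoint_STK : [disjoint ST & SK])
  (cover_STK : ST :|: SK = [set: I])
  (eps : R) (eps_gt0 : 0 < eps) (eps_lt1 : eps < 1) :
  exists N : rbm R (option I) (option I),
    (forall v h : config (option I),
       energy N v h = implication_energy ST SK eps v h) /\
    represented_by (implication ST SK) N.
Proof.
exists (implication_rbm ST SK eps); split=> [v h|].
  exact: energy_implication_rbm.
(* The rank is [- eps] times the truth value, so scaling by [eps^-1] suffices and no offset
   remains. *)
exists eps^-1, 0; split=> [|v]; first by rewrite invr_gt0.
rewrite energy_rank_implication_rbm // addr0 mulrA mulrNN mulVf ?mul1r //.
exact: lt0r_neq0.
Qed.
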